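(* Let $k\ge 1$ and $n>k+1$ be integers, and let $\omega=\omega_{n,k}$ be the largest zero of $T_n^{(k+1)}$. Then $$ \tau_{n,k}^2=\frac{(2k-1)!!}{(2k)!!}\,\frac{n}{n-k}\,\frac{1}{\binom{n+k}{n-k}}\,\frac{1}{(1-\omega^2)^k\,S_{n,k+1}(\omega)}, $$ where $$ S_{n,k+1}(x)=1+\sum_{m=1}^{k}\frac{(2m-1)!!}{(2m)!!}\,\frac{(k+1-m)_{2m}}{(1-x^2)^{m}}\prod_{j=1}^{m}\frac{1}{n^2-j^2}. $$
   Context: $T_n$ is the $n$-th Chebyshev polynomial of the first kind, $T_n(\cos\theta)=\cos n\theta$, and $T_n^{(k)}$ is its $k$-th derivative. For integers $k\ge1$ and $n\geq k+2$, $\omega_{n,k}$ denotes the largest (rightmost) zero of the polynomial $T_n^{(k+1)}$ (all of whose zeros are real and lie in $(-1,1)$), and $$\tau_{n,k}:=\frac{|T_n^{(k)}(\omega_{n,k})|}{T_n^{(k)}(1)}.$$ Notation: $(a)_j:=a(a+1)\cdots(a+j-1)$ for $j\in\mathbb{N}$; $(2m-1)!!=1\cdot3\cdots(2m-1)$ and $(2m)!!=2\cdot4\cdots(2m)$. *)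

(* Defs.v *)
From HB Require Import structures.
From mathcomp Require Import all_boot all_order all_algebra.
From mathcomp Require Import all_classical all_reals all_analysis.
From mathcomp Require Import ring lra.
Set Implicit Arguments.
Unset Strict Implicit.
Unset Printing Implicit Defensive.
Import Order.TTheory GRing.Theory Num.Theory.
Local Open Scope ring_scope.

Definition is_chebyshevT (R : realType) (n : nat) (T : {poly R}) : Prop :=
  forall theta : R, T.[cos theta] = cos (n%:R * theta).

Lemma chebyshevT_exists (R : realType) (n : nat) :
  exists T : {poly R}, is_chebyshevT n T.
Proof.
suff [T [U [HT _]]] : exists T U : {poly R},
  is_chebyshevT n T /\ is_chebyshevT n.+1 U by exists T.
elim: n => [|n [T [U [HT HU]]]].
  exists 1, 'X; split=> t; first by rewrite hornerC mul0r cos0.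
  by rewrite hornerX mul1r.
exists U, (2%:P * 'X * U - T); split=> // t.
rewrite !hornerE HU HT.
have -> : n.+2%:R * t = n.+1%:R * t + t by rewrite -[n.+2]addn1 natrD mulrDl mul1r.
have -> : n%:R * t = n.+1%:R * t - t by rewrite -[n.+1]addn1 natrD mulrDl mul1r addrK.
by rewrite cosB cosD; ring.
Qed.

Lemma chebyshevT_unique (R : realType) (n : nat) (T U : {poly R}) :
  is_chebyshevT n T -> is_chebyshevT n U -> T = U.
Proof.
move=> HT HU; apply/eqP; rewrite -subr_eq0; apply/eqP.
set p := T - U.
have inv_inj : injective (fun i : nat => (i.+1%:R : R)^-1).
  by move=> i j /invr_inj/eqP; rewrite eqr_nat eqSS => /eqP.
apply: (@roots_geq_poly_eq0 _ p [seq (i.+1%:R : R)^-1 | i <- iota 0 (size p)]).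
- apply/allP => x /mapP[i _ ->]; rewrite rootE.
  have i1 : -1 <= (i.+1%:R : R)^-1 <= 1.
    rewrite invf_le1 ?ler1n ?ltr0n // andbT.
    by apply: (@le_trans _ _ 0); rewrite ?lerN10 // invr_ge0 ler0n.
  have <- : cos (acos (i.+1%:R : R)^-1) = (i.+1%:R)^-1 by rewrite acosK ?in_itv.
  by rewrite hornerD hornerN HT HU subrr.
- by rewrite map_inj_uniq ?iota_uniq.
- by rewrite size_map size_iota.
Qed.

Definition is_largest_zero (R : realType) (p : {poly R}) (w : R) : Prop :=
  root p w /\ forall x : R, root p x -> x <= w.

Definition tau (R : realType) (T : {poly R}) (k : nat) (w : R) : R :=
  `|(T^`(k)).[w]| / (T^`(k)).[1].

(* (2m-1)!! / (2m)!!, with value 1 at m = 0 *)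
Definition dfact_ratio (R : realType) (m : nat) : R :=
  (\prod_(1 <= i < m.+1) (2 * i - 1))%N%:R / (\prod_(1 <= i < m.+1) (2 * i))%N%:R.

(* The rising factorial, as opposed to the falling factorial [a ^_ j]. *)
Definition pochhammer (a j : nat) : nat := (\prod_(i < j) (a + i))%N.

(* The second index is that of S itself: S_{n,k+1} is [chebS n k.+1]. *)
Definition chebS (R : realType) (n l : nat) (x : R) : R :=
  1 + \sum_(1 <= m < l)
        dfact_ratio R m * ((pochhammer (l - m) (2 * m))%:R / (1 - x ^+ 2) ^+ m)
        * \prod_(1 <= j < m.+1) (n%:R ^+ 2 - j%:R ^+ 2)^-1.

(* Main.v *)
(* The function y = T^(k+1) and its companion (the same derivative of
   sin(n arccos x)) have, up to the weight (1-x^2)^(2k+1), a sum of squares equal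
   to a constant times W(x) = (1-x^2)^k S_{n,k+1}(x).  The Wronskian of the two
   solutions is constant up to a weight, and it can be written in terms of [y] and
   W alone, so the companion is not needed: with z = (1-x^2) y' and suitable B, G
   built from W, the polynomial 2 (W z^2 - y z B) + y^2 G has zero derivative as
   soon as W satisfies the third-order equation of products of solutions.
   Comparing its values at w (where y = 0) and at 1 (where z = 0), and using the
   Chebyshev equation to express z(w) and y(1) through T^(k), gives
   tau^2 = W(1) / W(w). *)
Require Import Defs.
From mathcomp Require Import all_boot all_order all_algebra.
From mathcomp Require Import all_classical all_reals all_analysis.
From mathcomp Require Import ring lra.
Set Implicit Arguments.
Unset Strict Implicit.
Unset Printing Implicit Defensive.
Import Order.TTheory GRing.Theory Num.Theory.
Local Open Scope ring_scope.

(** * Differential equations of the Chebyshev polynomials *)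

Lemma deriv_natl (R : nzRingType) (n : nat) (p : {poly R}) :
  (n%:R * p)^`() = n%:R * p^`().
Proof. by rewrite !mulr_natl derivMn. Qed.

Lemma deriv_eq0_const (R : numDomainType) (p : {poly R}) :
  p^`() = 0 -> p = (p`_0)%:P.
Proof.
move=> dp0; apply/polyP => -[|i]; rewrite coefC //=.
have /eqP := coef_deriv p i.
by rewrite dp0 coef0 eq_sym mulrn_eq0 => /eqP.
Qed.

(** Algebraic form of the derivative of cos(n theta), obtained without differentiating in theta: the
    three-term recurrence propagates both relations together, and uniqueness transfers them to the
    given [T] and [U]. *)
Lemma chebyshevT_rel (R : realType) (n : nat) (T U : {poly R}) :
  is_chebyshevT n T -> is_chebyshevT n.+1 U ->
  (1 - 'X^2) * T^`() = n%:R * ('X * T - U) /\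
  (1 - 'X^2) * U^`() = n.+1%:R * (T - 'X * U).
Proof.
suff [T' [U' [hT' hU' rel]]] : exists T' U' : {poly R},
    [/\ is_chebyshevT n T', is_chebyshevT n.+1 U' &
     (1 - 'X^2) * T'^`() = n%:R * ('X * T' - U') /\
     (1 - 'X^2) * U'^`() = n.+1%:R * (T' - 'X * U')].
  by move=> /(chebyshevT_unique hT') <- /(chebyshevT_unique hU') <-.
elim: n => [|n [T' [U' [hT' hU' [rT rU]]]]].
  exists 1, 'X; split=> [t|t|]; first by rewrite hornerC mul0r cos0.
    by rewrite hornerX mul1r.
  by rewrite -polyC1 derivC derivX; split; ring.
exists U', (2%:R * 'X * U' - T'); split=> // [t|].
  have -> : n.+2%:R * t = n.+1%:R * t + t by rewrite -[n.+2]addn1 natrD mulrDl mul1r.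
  rewrite !hornerE hU' hT'.
  have -> : n%:R * t = n.+1%:R * t - t by rewrite -[n.+1]addn1 natrD mulrDl mul1r addrK.
  by rewrite cosB cosD; ring.
split; rewrite ?rU; first by ring.
rewrite derivB -!mulrA deriv_natl derivM derivX mul1r mulrBr rT.
have -> : (1 - 'X^2) * (2%:R * (U' + 'X * U'^`())) =
  2%:R * ((1 - 'X^2) * U' + 'X * ((1 - 'X^2) * U'^`())) by ring.
by rewrite rU -!natr1; ring.
Qed.

Lemma one_subX2_neq0 (R : nzRingType) : 1 - 'X^2 != 0 :> {poly R}.
Proof.
apply/eqP => /(congr1 (fun p : {poly R} => p`_0))/eqP.
by rewrite coefB coef1 coefXn subr0 coef0 oner_eq0.
Qed.

Lemma deriv_one_subX2 (R : nzRingType) :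
  (1 - 'X^2)^`() = - (2%:R * 'X) :> {poly R}.
Proof. by rewrite derivB derivXn -polyC1 derivC sub0r mulr_natl. Qed.

(** Differentiate the first relation and eliminate [U]; the extra factor 1 - X^2 lets both relations
    be substituted and is cancelled at the end. *)
Lemma chebyshevT_ode (R : realType) (n : nat) (T : {poly R}) :
  is_chebyshevT n T ->
  (1 - 'X^2) * T^`()^`() = 'X * T^`() - n%:R ^+ 2 * T.
Proof.
move=> hT; have [U hU] := chebyshevT_exists R n.+1.
have [rT rU] := chebyshevT_rel hT hU.
apply: (mulfI (one_subX2_neq0 R)).
have := congr1 (fun p => (1 - 'X^2) * p^`()) rT.
rewrite deriv_natl derivB !derivM deriv_one_subX2 derivX => e.
have -> : (1 - 'X^2) * ((1 - 'X^2) * T^`()^`()) =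
    (1 - 'X^2) * (- (2%:R * 'X) * T^`() + (1 - 'X^2) * T^`()^`())
    + 2%:R * 'X * ((1 - 'X^2) * T^`()) by ring.
rewrite e.
have -> : (1 - 'X^2) * (n%:R * (1 * T + 'X * T^`() - U^`())) =
    n%:R * ((1 - 'X^2) * T + 'X * ((1 - 'X^2) * T^`()) - (1 - 'X^2) * U^`())
  by ring.
have -> : (1 - 'X^2) * ('X * T^`() - n%:R ^+ 2 * T) =
    'X * ((1 - 'X^2) * T^`()) - (1 - 'X^2) * (n%:R ^+ 2 * T) by ring.
by rewrite rT rU -natr1; ring.
Qed.

Lemma chebyshevT_derivn_ode (R : realType) (n k : nat) (T : {poly R}) :
  is_chebyshevT n T ->
  (1 - 'X^2) * T^`(k.+2) =
    (2 * k + 1)%:R * ('X * T^`(k.+1)) - (n%:R ^+ 2 - k%:R ^+ 2) * T^`(k).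
Proof.
move=> hT; elim: k => [|k IHk].
  by rewrite !derivnS derivn0 (chebyshevT_ode hT); ring.
have := congr1 (fun p => p^`()) IHk.
have -> : n%:R ^+ 2 - k%:R ^+ 2 = (n%:R ^+ 2 - k%:R ^+ 2)%:P :> {poly R}.
  by rewrite polyCB !polyC_exp !polyC_natr.
rewrite derivM deriv_one_subX2 derivB deriv_natl deriv_mulC derivM derivX.
rewrite -!derivnS => e.
have -> : (1 - 'X^2) * T^`(k.+3) = (- (2%:R * 'X) * T^`(k.+2) +
   (1 - 'X^2) * T^`(k.+3)) + (2%:R * 'X) * T^`(k.+2) by ring.
by rewrite e polyCB !polyC_exp !polyC_natr -natr1; ring.
Qed.

(** * Amplitude equation and its invariant *)

(** For solutions u, v and s = 1 - X^2, if W = s^mu (u^2 + v^2) then this is 2 s^(mu+1) (u u' + v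
    v'). *)
Definition ampB (R : nzRingType) (mu : R) (W : {poly R}) : {poly R} :=
  (1 - 'X^2) * W^`() + (2%:R * mu)%:P * 'X * W.

(** In the same setting this is 2 s^(mu+2) (u'^2 + v'^2). *)
Definition ampG (R : nzRingType) (lam mu : R) (W : {poly R}) : {poly R} :=
  (2%:R * lam)%:P * (1 - 'X^2) * W + mu%:P * 'X * ampB mu W
  + (1 - 'X^2) * (ampB mu W)^`().

Definition amp_ode (R : nzRingType) (lam mu : R) (W : {poly R}) : {poly R} :=
  (2%:R * lam)%:P * ampB mu W + (ampG lam mu W)^`().

(* [W z^2 - y z B + y^2 G] is up to weights the squared Wronskian of [y] and a
   companion solution, [W] being the sum of the squares of the two solutions. *)
Lemma amplitude_invariant (R : idomainType) (lam mu : R) (y z W : {poly R}) :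
  (1 - 'X^2) * y^`() = z ->
  (1 - 'X^2) * z^`() = mu%:P * 'X * z - lam%:P * (1 - 'X^2) * y ->
  amp_ode lam mu W = 0 ->
  (2%:R * (W * z ^+ 2 - y * z * ampB mu W) + y ^+ 2 * ampG lam mu W)^`() = 0.
Proof.
set s := 1 - 'X^2; set B := ampB mu W; set G := ampG lam mu W => hy hz hG.
apply: (mulfI (one_subX2_neq0 R)); rewrite mulr0 -/s.
have hG' : G^`() = - ((2%:R * lam)%:P * B).
  by apply/eqP; rewrite -addr_eq0 addrC; apply/eqP.
have hW : s * W^`() = B - (2%:R * mu)%:P * 'X * W by rewrite /B /ampB addrK.
have hGE : G = (2%:R * lam)%:P * s * W + mu%:P * 'X * B + s * B^`() by [].
rewrite derivD deriv_natl derivB !expr2 !derivM hG'.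
have -> : s * (2%:R * (W^`() * (z * z) + W * (z^`() * z + z * z^`())
        - ((y^`() * z + y * z^`()) * B + y * z * B^`())) +
      ((y^`() * y + y * y^`()) * G + y * y * (- ((2%:R * lam)%:P * B)))) =
    2%:R * ((s * W^`()) * z * z + W * ((s * z^`()) * z *+ 2)
        - ((s * y^`()) * z + y * (s * z^`())) * B - y * z * (s * B^`())) +
      ((s * y^`()) * y *+ 2) * G - s * y * y * ((2%:R * lam)%:P * B) by ring.
by rewrite hy hz hW hGE !polyCM !polyC_natr; ring.
Qed.

Lemma amp_odeD (R : comNzRingType) (lam mu : R) :
  {morph amp_ode lam mu : V W / V + W}.
Proof.
move=> V W; rewrite /amp_ode /ampG /ampB.
by rewrite !(derivD, derivM); ring.
Qed.

Lemma amp_odeZ (R : comNzRingType) (lam mu c : R) (W : {poly R}) :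
  amp_ode lam mu (c *: W) = c *: amp_ode lam mu W.
Proof.
rewrite /amp_ode /ampG /ampB -!mul_polyC.
by rewrite !(derivC, derivD, derivM); ring.
Qed.

(** With k = m + p fixed, each power of 1 - X^2 has a two-term image, so the amplitude equation
    becomes a first-order recurrence on coefficients. At p = 0 the value of [p.-1] is harmless, its
    coefficient being 0. *)
Lemma amp_ode_one_subX2_exp (R : comNzRingType) (N : R) (m p : nat) :
  amp_ode (N - (m + p).+1%:R ^+ 2) (2 * (m + p) + 1)%:R ((1 - 'X^2) ^+ p) =
  (2%:R * 'X) * ((4%:R * m%:R * (N - m%:R ^+ 2)) *: (1 - 'X^2) ^+ p
     - (2%:R * p%:R * (2 * m + p + 1)%:R * (2 * m + 1)%:R)
         *: (1 - 'X^2) ^+ p.-1).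
Proof.
set s : {poly R} := 1 - 'X^2; set c : R := 2%:R * (2 * m + p + 1)%:R.
have ds : s^`() = (- 2%:R)%:P * 'X.
  by rewrite deriv_one_subX2 polyCN polyC_natr mulNr.
have dE q : (s ^+ q.+1)^`() = (- 2%:R)%:P * 'X * s ^+ q * q.+1%:R%:P.
  by rewrite deriv_exp ds polyC_natr mulr_natr.
have BE : ampB ((2 * (m + p) + 1)%:R : R) (s ^+ p) = c%:P * ('X * s ^+ p).
  rewrite /ampB -/s /c !polyCM !polyC_natr; case: {c}p => [|q].
    by rewrite expr0 (_ : 1^`() = 0) -?polyC1 ?derivC; ring.
  by rewrite dE polyCN !polyC_natr exprS; ring.
rewrite /amp_ode /ampG BE -/s -!mul_polyC.
have : s = 1 - 'X^2 by []; clearbody s => sE.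
(* Two differentiations lower the exponent by up to two, hence the separate cases p = 0 and p =
   1. *)
case: p @c BE => [|[|q]] c _; rewrite [_.-1]/= ?expr0 ?expr1.
- rewrite -polyC1 !(derivC, derivD, derivM, derivX, ds) /c.
  by rewrite !(polyCM, polyCB, polyCN, polyC_exp, polyC_natr, polyC1) sE; ring.
- rewrite !(derivC, derivD, derivM, derivX, ds) -polyC1 ?derivC /c.
  by rewrite !(polyCM, polyCB, polyCN, polyC_exp, polyC_natr, polyC1) sE; ring.
- rewrite !(dE, ds, derivC, derivX, derivD, derivM) -polyC1 ?derivC /c.
  rewrite !(polyCM, polyCB, polyCN, polyC_exp, polyC_natr, polyC1) !(exprS s).
  by move: (s ^+ q) => e; rewrite sE; ring.
Qed.

(** * The polynomial (1 - x^2)^k S and its coefficients *)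

Lemma dfact_ratioS (R : realType) (m : nat) :
  dfact_ratio R m.+1 * (2 * m.+1)%:R = dfact_ratio R m * (2 * m + 1)%:R.
Proof.
have nz j : ((\prod_(1 <= i < j.+1) (2 * i))%N%:R : R) != 0.
  rewrite pnatr_eq0 -lt0n big_nat_cond prodn_cond_gt0 // => i.
  by rewrite andbT => /andP[i0 _]; rewrite muln_gt0.
have odd_idx : (2 * m.+1 - 1 = 2 * m + 1)%N by rewrite mulnS addnC -addnBA.
have n2 : ((2 * m.+1)%:R : R) != 0 by rewrite pnatr_eq0.
rewrite /dfact_ratio !(big_nat_recr m.+1) //= odd_idx.
move: (nz m) n2; move: (2 * m.+1)%N (2 * m + 1)%N => e o.
rewrite !natrM; move: (\prod_(_ <= i < _) (2 * i))%N%:R => a a0 e0.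
by field; rewrite a0 e0.
Qed.

Lemma dfact_ratio_neq0 (R : realType) (m : nat) : dfact_ratio R m != 0.
Proof.
elim: m => [|m IHm].
  by rewrite /dfact_ratio !big_geq // divr1 oner_neq0.
apply/eqP => D0; have /esym/eqP := dfact_ratioS R m.
by rewrite D0 mul0r mulf_eq0 (negPf IHm) pnatr_eq0 addn1.
Qed.

Lemma pochhammerSS (a j : nat) :
  pochhammer a j.+2 = (a * pochhammer a.+1 j * (a + j.+1))%N.
Proof.
rewrite /pochhammer big_ord_recr big_ord_recl /= addn0; congr (_ * _ * _)%N.
by apply: eq_bigr => i _; rewrite /bump /= add1n addnS.
Qed.

Lemma pochhammer1 (j : nat) : pochhammer 1 j = j`!.
Proof.
rewrite /pochhammer fact_prod big_add1 big_mkord.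
by apply: eq_bigr => i _; rewrite add1n.
Qed.

Definition chebS_coef (R : realType) (n k m : nat) : R :=
  dfact_ratio R m * (pochhammer (k.+1 - m) (2 * m))%:R
  * \prod_(1 <= j < m.+1) (n%:R ^+ 2 - j%:R ^+ 2)^-1.

Lemma natr_sqrB_neq0 (R : numDomainType) (n j : nat) :
  (j < n)%N -> n%:R ^+ 2 - j%:R ^+ 2 != 0 :> R.
Proof.
by move=> jn; rewrite subr_eq0 -!natrX eqr_nat eqn_exp2r // gtn_eqF.
Qed.

Lemma chebS_coefS (R : realType) (n k m : nat) : (m <= k < n)%N ->
  chebS_coef R n k m.+1 * (4%:R * m.+1%:R * (n%:R ^+ 2 - m.+1%:R ^+ 2)) =
  chebS_coef R n k m
    * (2%:R * (k - m)%:R * (2 * m + (k - m) + 1)%:R * (2 * m + 1)%:R).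
Proof.
case/andP=> mk kn; rewrite /chebS_coef subSS subSn //.
rewrite mulnS pochhammerSS (big_nat_recr m.+1) //=.
have dS := dfact_ratioS R m.
(* For m = k the factor n^2 - (k+1)^2 may vanish, but both sides are 0 through k - m. *)
case: (eqVneq m k) => [->|mk'].
  by rewrite subnn !mul0n !(mulr0, mul0r).
have nz := @natr_sqrB_neq0 R n m.+1 _.
have {nz}: n%:R ^+ 2 - m.+1%:R ^+ 2 != 0 :> R.
  by apply: nz; apply: leq_ltn_trans kn; rewrite ltn_neqAle mk' mk.
move: (n%:R ^+ 2 - m.+1%:R ^+ 2) => u u0.
move: (\prod_(_ <= j < _) _) => P.
rewrite -[(2 * m).+1]addn1 addnA [((k - m) + _)%N]addnC.
move: (dfact_ratio R m.+1) (dfact_ratio R m) dS => D1 D dS.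
rewrite !(natrM R (_ * _)) [(_ * pochhammer _ _)%:R]natrM.
move: (pochhammer _ _)%:R (2 * m + (k - m) + 1)%:R (k - m)%:R => A C B.
have -> : D1 * (B * A * C) * (P / u) * (4%:R * m.+1%:R * u) =
    (D1 * (2 * m.+1)%:R) * (2%:R * B * A * C * P) by field.
by rewrite dS; ring.
Qed.

(** The W of the overview: S with its denominators cleared, hence defined at 1 too. *)
Definition chebS_poly (R : realType) (n k : nat) : {poly R} :=
  \sum_(0 <= m < k.+1) chebS_coef R n k m *: (1 - 'X^2) ^+ (k - m).

Lemma amp_ode_chebS_poly (R : realType) (n k : nat) : (k < n)%N ->
  amp_ode (n%:R ^+ 2 - k.+1%:R ^+ 2) (2 * k + 1)%:R (chebS_poly R n k) = 0.
Proof.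
move=> kn; set L := amp_ode _ _.
have L0 : L 0 = 0 by rewrite -[X in L X](scale0r (0 : {poly R})) /L amp_odeZ scale0r.
(* By [chebS_coefS] the image of the m-th summand is [t m - t m.+1], and [t] vanishes at 0 and at k
   + 1. *)
pose t m := (2%:R * 'X) * ((chebS_coef R n k m
  * (4%:R * m%:R * (n%:R ^+ 2 - m%:R ^+ 2))) *: (1 - 'X^2) ^+ (k - m)).
rewrite /chebS_poly (big_morph L (@amp_odeD _ _ _) L0).
rewrite (@telescope_sumr_eq _ _ _ (fun m => - t m)) // => [|m /=].
  (* the coefficient of index k+1 vanishes, its Pochhammer factor starting at 0 *)
  rewrite /t /chebS_coef subnn /pochhammer big_ord_recl.
  by rewrite !(mul0n, mulr0, mul0r, scale0r, oppr0, subr0).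
rewrite ltnS => mk; rewrite /L amp_odeZ.
have := amp_ode_one_subX2_exp (n%:R ^+ 2 : R) m (k - m).
rewrite subnKC // => ->; rewrite /t chebS_coefS ?mk // subnS.
by rewrite -!mul_polyC !polyCM; ring.
Qed.

Lemma chebS_poly1 (R : realType) (n k : nat) : (k < n)%N ->
  (chebS_poly R n k).[1] =
    dfact_ratio R k * (n%:R / (n%:R - k%:R)) * ('C(n + k, n - k)%:R)^-1.
Proof.
move=> kn; rewrite /chebS_poly big_nat_recr //= subnn expr0 hornerD.
rewrite [X in X + _](_ : _ = 0) ?add0r; last first.
  rewrite horner_sum big_nat_cond big1 // => m; rewrite andbT => /= mk.
  by rewrite !hornerE expr1n subrr expr0n subn_eq0 leqNgt mk mulr0.
rewrite hornerZ hornerC mulr1 /chebS_coef subSnn pochhammer1.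
move: (dfact_ratio R k) => D; rewrite -!mulrA; congr (_ * _).
have binE : 'C(n + k, n - k)%:R * (2 * k)`!%:R = ((n + k) ^_ (2 * k))%:R :> R.
  rewrite -natrM -(bin_ffact (n + k)) -(@bin_sub _ (2 * k)).
    by rewrite mul2n -addnn subnDr.
  by rewrite mul2n -addnn leq_add2r ltnW.
(* The extra factor n - k makes the product symmetric about n, so that n - j pairs with n + j. *)
have ffactE : ((n + k) ^_ (2 * k))%:R * (n%:R - k%:R) =
    n%:R * \prod_(1 <= j < k.+1) (n%:R ^+ 2 - j%:R ^+ 2) :> R.
  elim: k kn {binE} => [|k IHk] kn.
    by rewrite big_geq // ffactn0; ring.
  rewrite big_nat_recr //= mulrA -IHk 1?ltnW // mulnS addnS ffactSS ffactnSr.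
  have -> : (n + k - 2 * k = n - k)%N by rewrite mul2n -addnn subnDr.
  by rewrite !natrM natrB ?(ltnW (ltnW kn)) //; ring.
have binN0 : 'C(n + k, n - k)%:R != 0 :> R.
  by rewrite pnatr_eq0 -lt0n bin_gt0 (leq_trans (leq_subr k n)) ?leq_addr.
have nkN0 : n%:R - k%:R != 0 :> R by rewrite -natrB 1?ltnW // pnatr_eq0 subn_eq0 -ltnNge.
have prodN0 : \prod_(1 <= j < k.+1) (n%:R ^+ 2 - j%:R ^+ 2) != 0 :> R.
  rewrite prodf_seq_neq0; apply/allP => j; rewrite mem_index_iota => /andP[_ jk] /=.
  by rewrite natr_sqrB_neq0 // (leq_ltn_trans _ kn).
rewrite prodfV; apply: (mulIf prodN0); rewrite divfK //.
apply: (mulfI binN0); rewrite binE; apply: (mulIf nkN0).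
rewrite ffactE.
by field; rewrite binN0.
Qed.

Lemma chebS_polyE (R : realType) (n k : nat) (x : R) : 1 - x ^+ 2 != 0 ->
  (chebS_poly R n k).[x] = (1 - x ^+ 2) ^+ k * chebS n k.+1 x.
Proof.
move=> x0; rewrite /chebS_poly /chebS horner_sum big_nat_recl // mulrDr mulr1.
have sE j : ((1 - 'X^2) ^+ j).[x] = (1 - x ^+ 2) ^+ j by rewrite !hornerE.
congr (_ + _).
  rewrite /chebS_coef /dfact_ratio /pochhammer muln0 big_ord0 !big_geq //.
  by rewrite !(mulr1n, divr1, mulr1, scale1r) sE subn0.
rewrite mulr_sumr big_add1; apply: eq_big_nat => m /= mk.
rewrite hornerZ sE.
have -> : (1 - x ^+ 2) ^+ k = (1 - x ^+ 2) ^+ (k - m.+1) * (1 - x ^+ 2) ^+ m.+1.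
  by rewrite -exprD subnK.
rewrite /chebS_coef; move: (\prod_(_ <= j < _) _) => P.
have : (1 - x ^+ 2) ^+ m.+1 != 0 by rewrite expf_neq0.
by move: ((1 - x ^+ 2) ^+ m.+1) => e e0; field.
Qed.

Lemma chebS_poly1_neq0 (R : realType) (n k : nat) :
  (k < n)%N -> (chebS_poly R n k).[1] != 0.
Proof.
move=> kn; rewrite chebS_poly1 //.
have n0 : n%:R != 0 :> R by rewrite pnatr_eq0 -lt0n (leq_ltn_trans _ kn).
have nk0 : n%:R - k%:R != 0 :> R.
  by rewrite -natrB ?(ltnW kn) // pnatr_eq0 subn_eq0 -ltnNge.
have bin0 : 'C(n + k, n - k)%:R != 0 :> R.
  by rewrite pnatr_eq0 -lt0n bin_gt0 (leq_trans (leq_subr k n)) ?leq_addr.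
apply: mulf_neq0 (invr_neq0 bin0).
exact: mulf_neq0 (dfact_ratio_neq0 R k) (mulf_neq0 n0 (invr_neq0 nk0)).
Qed.

(** * Endpoint values and the comparison of w with 1 *)

Lemma cos_natmul_pi_neq0 (R : realType) (n : nat) : cos (n%:R * pi : R) != 0.
Proof.
elim: n => [|n IHn]; first by rewrite mul0r cos0 oner_eq0.
by rewrite -natr1 mulrDl mul1r cosDpi oppr_eq0.
Qed.

(** At an endpoint the leading coefficient of the equation vanishes, leaving (2j+1) e T^(j+1)(e) =
    (n^2 - j^2) T^(j)(e), whose right factor is nonzero for j < n. *)
Lemma chebyshevT_derivn_end_neq0 (R : realType) (n j : nat) (T : {poly R})
    (e : R) :
  is_chebyshevT n T -> e ^+ 2 = 1 -> (j <= n)%N -> (T^`(j)).[e] != 0.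
Proof.
move=> hT e2; elim: j => [|j IHj] jn.
  have /orP[/eqP->|/eqP->] : (e == 1) || (e == -1) by rewrite -sqrf_eq1 e2.
    by rewrite derivn0 -cos0 hT mulr0 cos0 oner_eq0.
  by rewrite derivn0 -cospi hT cos_natmul_pi_neq0.
have := congr1 (horner^~ e) (chebyshevT_derivn_ode j hT).
have -> : n%:R ^+ 2 - j%:R ^+ 2 = (n%:R ^+ 2 - j%:R ^+ 2)%:P :> {poly R}.
  by rewrite polyCB !polyC_exp !polyC_natr.
rewrite -(polyC_natr _ (2 * j + 1)) !hornerE e2 subrr mul0r => /esym/eqP.
rewrite subr_eq0 => /eqP h; apply/eqP => T0; move: h.
rewrite T0 /= !mulr0 => /esym/eqP.
by rewrite mulf_eq0 (negPf (IHj (ltnW jn))) (negPf (natr_sqrB_neq0 _ jn)).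
Qed.

Theorem theorem1p1 (R : realType) (n k : nat) (T : {poly R}) (w : R)
    (hk : (1 <= k)%N) (hn : (k + 1 < n)%N)
    (hT : is_chebyshevT n T)
    (hw : is_largest_zero (T^`(k.+1)) w) :
  tau T k w ^+ 2 =
    dfact_ratio R k * (n%:R / (n%:R - k%:R)) * ('C(n + k, n - k)%:R)^-1
    * ((1 - w ^+ 2) ^+ k * chebS n k.+1 w)^-1.
Proof.
rewrite addn1 in hn; have kn := ltnW hn.
have [/rootP yw _] := hw.
(* The zero w is not an endpoint, so S is related to W there. *)
have w2 : 1 - w ^+ 2 != 0.
  rewrite subr_eq0 eq_sym; apply/eqP => w2.
  by have := chebyshevT_derivn_end_neq0 hT w2 kn; rewrite yw eqxx.
have f1 := chebyshevT_derivn_end_neq0 hT (expr1n _ 2) (ltnW kn).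
have M0 := natr_sqrB_neq0 R kn.
rewrite -chebS_poly1 // -chebS_polyE //.
pose M : R := n%:R ^+ 2 - k%:R ^+ 2.
pose lam : R := n%:R ^+ 2 - k.+1%:R ^+ 2; pose mu : R := (2 * k + 1)%:R.
pose W := chebS_poly R n k; pose y := T^`(k.+1).
pose z := (1 - 'X^2) * T^`(k.+2).
have zE : z = mu%:P * ('X * y) - M%:P * T^`(k).
  by rewrite /z (chebyshevT_derivn_ode k hT) /mu /M polyCB !polyC_exp !polyC_natr.
have zode : (1 - 'X^2) * z^`() = mu%:P * 'X * z - lam%:P * (1 - 'X^2) * y.
  rewrite {1}/z derivM deriv_one_subX2 -derivnS (chebyshevT_derivn_ode k.+1 hT).
  by rewrite /z /mu /lam polyCB !polyC_exp !polyC_natr; ring.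
have := amplitude_invariant (y := y) (erefl z) zode (amp_ode_chebS_poly R kn).
rewrite -/W; move=> /deriv_eq0_const cst.
(* The invariant is a constant polynomial: its values at 1 and at w agree. *)
have := congr1 (horner^~ 1) cst; rewrite hornerC -[RHS](hornerC _ w) -cst.
have z1 : z.[1] = 0 by rewrite /z !hornerE expr1n subrr mul0r.
have zw : z.[w] = - M * (T^`(k)).[w].
  by rewrite zE !hornerE yw /= mulr0 sub0r mulNr.
have y1 : mu * y.[1] = M * (T^`(k)).[1].
  by apply/eqP; rewrite -subr_eq0 -[X in _ == X]z1 zE !hornerE /= mulr1.
have G1 : (ampG lam mu W).[1] = 2%:R * mu ^+ 2 * W.[1].
  rewrite /ampG /ampB !hornerE expr1n subrr /=; ring.
have {}yw : y.[w] = 0 by [].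
have W1N0 : W.[1] != 0 by exact: chebS_poly1_neq0.
rewrite -/W; move: (ampG lam mu W) (ampB mu W) G1 => G B G1.
move: W y z {zE zode cst} z1 zw y1 G1 yw W1N0 => W y z z1 zw y1 G1 yw W1N0.
rewrite !hornerE z1 yw zw G1 /= => FE.
(* At 1 only the y^2 G term survives, at w only the W z^2 term; [y1] turns mu y(1) into M
   T^(k)(1). *)
have {}FE : M ^+ 2 * ((T^`(k)).[1] ^+ 2 * W.[1])
    = M ^+ 2 * ((T^`(k)).[w] ^+ 2 * W.[w]).
  rewrite mulrA -exprMn -y1. lra.
have {}FE := mulfI (expf_neq0 2 M0) FE.
(* The left side of [FE] is nonzero, which forces W(w) to be nonzero. *)
have WwN0 : W.[w] != 0.
  apply/eqP => Ww0; move/eqP: FE; rewrite Ww0 mulr0 mulf_eq0.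
  by rewrite (negPf W1N0) (negPf (expf_neq0 2 f1)).
rewrite /tau expr_div_n real_normK ?num_real //.
by apply/eqP; rewrite eqr_div ?expf_neq0 // -FE mulrC.
Qed.
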